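(* The generalized Weyl algebra $A=D[x,y;\sigma,\tau,a]$ exists. It is a $\mathbb{Z}$-graded ring $A=\bigoplus_{i\in\mathbb{Z}}A_i$ where $A_i=Dv_i\simeq{}_DD$ (as left $D$-modules), $v_0=1$, $v_i=x^i$ and $v_{-i}=y^i$ for $i\ge 1$. In particular, the left $D$-module ${}_DA$ is free.
   Context: Generalized Weyl algebra (GWA): let $D$ be a ring (associative, with 1), $\sigma,\tau$ ring endomorphisms of $D$ and $a\in D$ such that $\tau\sigma(a)=a$, $ad=\tau\sigma(d)a$ and $\sigma(a)d=\sigma\tau(d)\sigma(a)$ for all $d\in D$. Then $A=D[x,y;\sigma,\tau,a]$ is the ring generated by $D$, $x$ and $y$ subject to the defining relations $xd=\sigma(d)x$, $yd=\tau(d)y$ for all $d\in D$, $yx=a$, $xy=\sigma(a)$. Products of endomorphisms are compositions. *)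

(* Defs.v *)
From HB Require Import structures.
From mathcomp Require Import all_boot all_order all_algebra.
From mathcomp Require Import finmap.
From mathcomp Require Import classical_sets.

Set Implicit Arguments.
Unset Strict Implicit.
Unset Printing Implicit Defensive.

Import GRing.Theory.
Local Open Scope ring_scope.
Local Open Scope classical_set_scope.

(* [pzRingType] is the class of associative unital rings, the zero ring      *)
(* included; ring morphisms preserve 1.                                      *)

Section GWA.
Variables (D : pzRingType) (sigma tau : {rmorphism D -> D}) (a : D).

Definition gwa_relations (B : pzRingType) (f : {rmorphism D -> B}) (x y : B) :=
  [/\ forall d, x * f d = f (sigma d) * x,
      forall d, y * f d = f (tau d) * y,
      y * x = f a
    & x * y = f (sigma a)].

Definition generated_by (A : pzRingType) (f : {rmorphism D -> A}) (x y : A) :=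
  forall S : {pred A}, subring_closed S ->
    (forall d, f d \in S) -> x \in S -> y \in S -> forall u, u \in S.

(* (A, iota, x, y) is the ring generated by D, x, y subject to the defining  *)
(* relations [gwa_relations].  The last clause says that no relation holds   *)
(* in A beyond their consequences; the induced morphism is unique because A  *)
(* is generated by iota(D), x and y.  The map iota : D -> A is not assumed   *)
(* to be injective.                                                          *)
Definition is_gwa (A : pzRingType) (iota : {rmorphism D -> A}) (x y : A) :=
  [/\ gwa_relations iota x y,
      generated_by iota x y
    & forall (B : pzRingType) (f : {rmorphism D -> B}) (x' y' : B),
        gwa_relations f x' y' ->
        exists g : {rmorphism A -> B},
          [/\ forall d, g (iota d) = f d, g x = x' & g y = y']].

End GWA.

(* The ring A as a left D-module along f : D -> A.                           *)
Definition left_mod (D A : pzRingType) (f : {rmorphism D -> A}) : Type := A.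

Section LeftMod.
Variables (D A : pzRingType) (f : {rmorphism D -> A}).

HB.instance Definition _ := GRing.Zmodule.on (left_mod f).

Definition left_mod_scale (d : D) (u : left_mod f) : left_mod f :=
  f d * (u : A).

Lemma left_mod_scaleA d e u :
  left_mod_scale d (left_mod_scale e u) = left_mod_scale (d * e) u.
Proof. by rewrite /left_mod_scale rmorphM mulrA. Qed.

Lemma left_mod_scale1 : left_id 1 left_mod_scale.
Proof. by move=> u; rewrite /left_mod_scale rmorph1 mul1r. Qed.

Lemma left_mod_scaleDr : right_distributive left_mod_scale +%R.
Proof. by move=> d u v; rewrite /left_mod_scale mulrDr. Qed.

Lemma left_mod_scaleDl u : {morph left_mod_scale^~ u : d e / d + e}.
Proof. by move=> d e; rewrite /left_mod_scale rmorphD mulrDl. Qed.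

HB.instance Definition _ := GRing.Zmodule_isLmodule.Build D (left_mod f)
  left_mod_scaleA left_mod_scale1 left_mod_scaleDr left_mod_scaleDl.

End LeftMod.

Definition is_free_module (D : pzRingType) (M : lmodType D) :=
  exists (I : choiceType) (b : I -> M), forall u : M,
    exists! c : {fsfun I -> D with 0},
      u = \sum_(i <- finsupp c) c i *: b i.

Definition is_additive_subgroup (V : zmodType) (S : set V) :=
  S 0 /\ forall u v, S u -> S v -> S (u - v).

Definition is_direct_sum (V : zmodType) (C : int -> set V) :=
  forall u : V, exists! c : {fsfun int -> V with 0},
    (forall i, C i (c i)) /\ u = \sum_(i <- finsupp c) c i.

Definition is_Zgrading (A : pzRingType) (C : int -> set A) :=
  [/\ forall i, is_additive_subgroup (C i),
      is_direct_sum C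
    & forall i j u v, C i u -> C j v -> C (i + j) (u * v)].

(* [Negz n] is the integer - (n + 1).                                        *)
Definition gwa_v (A : pzRingType) (x y : A) (i : int) : A :=
  match i with
  | Posz n => x ^+ n
  | Negz n => y ^+ n.+1
  end.

Definition gwa_comp (D A : pzRingType) (iota : {rmorphism D -> A}) (x y : A)
    (i : int) : set A :=
  [set u | exists d : D, u = iota d * gwa_v x y i].

(* Main.v *)
From HB Require Import structures.
Require Import Defs.
From mathcomp Require Import all_boot all_order all_algebra.
From mathcomp Require Import finmap monalg.
From mathcomp Require Import classical_sets.

Set Implicit Arguments.
Unset Strict Implicit.
Unset Printing Implicit Defensive.

Import GRing.Theory.
Local Open Scope ring_scope.
Local Open Scope classical_set_scope.

(** In a ring generated by D, x and y subject to the relations, moving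
   coefficients to the left turns x v_i and y v_i into known multiples of
   v_(i+1) and v_(i-1); hence the products d v_i span. What has to be
   seen is that they are independent, and this calls for a model in which they
   visibly are.

   The model lives on the left D-module [laurent] of finitely supported
   functions int -> D, with basis e_i. Left multiplication by x and y is
   prescribed by what it has to be in A:
     X (d e_i) = sigma(d) c_i e_(i+1),  Y (d e_i) = tau(d) c'_i e_(i-1),
   where c_i = sigma(a) if i < 0 and 1 otherwise, and c'_i = a if i > 0 and 1
   otherwise. The three hypotheses on sigma, tau and a are exactly what makes
   Y X and X Y act as a and sigma(a) ([shift_action]).

   Call [gwa_action] a D-module N with operators X, Y of this kind. A function
   m acts on N by m . n = sum_i m_i V_i n, where V_i is a power of X or of Y,
   and X V_i = c_i V_(i+1), Y V_i = c'_i V_(i-1) on N ([X_gwa_op],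
   [Y_gwa_op]). So the operators X and Y of [laurent] and those of N
   correspond under m |-> m . n, whence (l . m) . n = l . (m . n)
   ([gwa_act_comp]). This identity is used twice. With N = [laurent] it says
   that (m, n) |-> m . n is an associative product, which makes [laurent] the
   ring [gwa_model]. With N a ring B satisfying the relations, it says that
   m |-> m . 1 is a ring morphism to B, which is the universal property
   ([model_is_gwa]).

   Any other ring A with the universal property is isomorphic to the model,
   so each element of A has coordinates along the v_i, finitely many nonzero
   ([gwa_coordinates]). The direct sum decomposition and the freeness are read
   off from them; A_i A_j lies in A_(i+j) because multiplication by x and y
   shifts the degree by one ([gwa_comp_mul]). *)

(** * Additive maps on finitely supported functions *)

Section FiniteSupport.
Variables (K : choiceType) (G V : zmodType).
Implicit Types (m : {malg G[K]}) (F : K -> G -> V).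

Definition malg_lift F m : V := \sum_(k <- msupp m) F k m@_k.

Lemma malg_additive_ext (f g : {malg G[K]} -> V) :
    zmod_morphism f -> zmod_morphism g ->
    (forall k c, f << c *g k >> = g << c *g k >>) ->
  f =1 g.
Proof.
move=> fB gB fgU m.
pose f' : {additive {malg G[K]} -> V} :=
  HB.pack f (GRing.isZmodMorphism.Build _ _ f fB).
pose g' : {additive {malg G[K]} -> V} :=
  HB.pack g (GRing.isZmodMorphism.Build _ _ g gB).
rewrite -[f]/(f' : _ -> _) -[g]/(g' : _ -> _) (monalgE m) !raddf_sum.
by apply: eq_bigr => k _; apply: fgU.
Qed.

Variable F : K -> G -> V.
Hypothesis F_additive : forall k, zmod_morphism (F k).

Lemma malg_lift0 k : F k 0 = 0.
Proof. by rewrite -[X in F _ X](subrr 0) F_additive subrr. Qed.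

Lemma malg_liftEw m (S : {fset K}) : (msupp m `<=` S)%fset ->
  malg_lift F m = \sum_(k <- S) F k m@_k.
Proof.
move=> mS; apply: (big_fset_incl _ mS) => k _ km.
by rewrite (mcoeff_outdom km) malg_lift0.
Qed.

Lemma malg_lift_additive : zmod_morphism (malg_lift F).
Proof.
move=> m n.
rewrite (malg_liftEw (msuppB_le m n)) (malg_liftEw (fsubsetUl _ (msupp n))).
rewrite (malg_liftEw (fsubsetUr (msupp m) _)) -sumrB.
by apply: eq_bigr => k _; rewrite mcoeffB F_additive.
Qed.

Lemma malg_liftU k c : malg_lift F << c *g k >> = F k c.
Proof. by rewrite (malg_liftEw msuppU_le) big_seq_fset1 mcoeffUU. Qed.

End FiniteSupport.

(** * Modules with an action of x and y *)

Section Action.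
Variables (D : pzRingType) (sigma tau : {rmorphism D -> D}) (a : D).

(** A left module over the generalized Weyl algebra, described by its
   D-module structure and the action of x and y, so that it makes sense before
   the algebra has been constructed. *)
Record gwa_action (N : lmodType D) (X Y : N -> N) : Prop := GwaAction {
  gwa_XB : zmod_morphism X;
  gwa_YB : zmod_morphism Y;
  gwa_XZ : forall d n, X (d *: n) = sigma d *: X n;
  gwa_YZ : forall d n, Y (d *: n) = tau d *: Y n;
  gwa_YX : forall n, Y (X n) = a *: n;
  gwa_XY : forall n, X (Y n) = sigma a *: n }.

(** The coefficients c_i and c'_i in x v_i = c_i v_(i+1) and
   y v_i = c'_i v_(i-1). They differ from 1 only when a factor x meets a power
   of y, or a factor y meets a power of x, and one pair cancels. *)
Definition xcoef (i : int) : D := if i is Negz _ then sigma a else 1.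
Definition ycoef (i : int) : D := if i is Posz n.+1 then a else 1.

Lemma Negz_succ n : Negz n.+1 + 1 = Negz n.
Proof. by rewrite !NegzE -addn1 PoszD opprD addrNK. Qed.

Lemma Posz_pred n : Posz n.+1 - 1 = Posz n.
Proof. by rewrite -addn1 PoszD addrK. Qed.

Lemma Negz_pred n : Negz n - 1 = Negz n.+1.
Proof. by rewrite -Negz_succ addrK. Qed.

Section Module.
Variables (N : lmodType D) (X Y : N -> N).

(** The action of v_i. *)
Definition gwa_op (i : int) : N -> N :=
  match i with Posz n => iter n X | Negz n => iter n.+1 Y end.

Definition gwa_act (m : {malg D[int]}) (n : N) : N :=
  malg_lift (fun i d => d *: gwa_op i n) m.

Hypothesis XY_action : gwa_action X Y.

Lemma X_gwa_op i n : X (gwa_op i n) = xcoef i *: gwa_op (i + 1) n.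
Proof.
case: i => [i|[|i]].
- by rewrite scale1r -PoszD addn1.
- by rewrite /= (gwa_XY XY_action).
- by rewrite Negz_succ /= (gwa_XY XY_action).
Qed.

Lemma Y_gwa_op i n : Y (gwa_op i n) = ycoef i *: gwa_op (i - 1) n.
Proof.
case: i => [[|i]|i].
- by rewrite scale1r.
- by rewrite Posz_pred /= (gwa_YX XY_action).
- by rewrite Negz_pred /= scale1r.
Qed.

Lemma gwa_act_coefB n i : zmod_morphism (fun d => d *: gwa_op i n).
Proof. by move=> d e; rewrite scalerBl. Qed.

Lemma gwa_actBl n : zmod_morphism (gwa_act^~ n).
Proof. exact/malg_lift_additive/gwa_act_coefB. Qed.

Lemma gwa_actU d i n : gwa_act << d *g i >> n = d *: gwa_op i n.
Proof. by rewrite /gwa_act (malg_liftU (gwa_act_coefB n)). Qed.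

Lemma gwa_opB i : zmod_morphism (gwa_op i).
Proof.
have iterB f (fB : zmod_morphism f) k : zmod_morphism (iter k f : N -> N).
  by elim: k => [|k IHk] u v //=; rewrite IHk fB.
case: i => i; apply: iterB; first exact: gwa_XB XY_action.
exact: gwa_YB XY_action.
Qed.

Lemma gwa_actBr m : zmod_morphism (gwa_act m).
Proof.
move=> n1 n2; rewrite /gwa_act /malg_lift -sumrB; apply: eq_bigr => i _.
by rewrite gwa_opB scalerBr.
Qed.

End Module.

(** * The model: shift operators and the product *)

(** A copy of [{malg D[int]}] on which the D-module structure is put for an
   arbitrary D, the zero ring included. *)
Definition laurent : Type := {malg D[int]}.
HB.instance Definition _ := GRing.Zmodule.on laurent.

Definition laurent_scale (d : D) : laurent -> laurent :=
  malg_lift (fun i e => << d * e *g i >>).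

Lemma laurent_coefB d i :
  zmod_morphism (fun e : D => << d * e *g i >> : {malg D[int]}).
Proof. by move=> e1 e2; rewrite mulrBr monalgUB. Qed.

Lemma laurent_scaleB d : zmod_morphism (laurent_scale d).
Proof. exact/malg_lift_additive/laurent_coefB. Qed.

Lemma laurent_scaleU d e i : laurent_scale d << e *g i >> = << d * e *g i >>.
Proof. exact: (malg_liftU (laurent_coefB d)). Qed.

Lemma laurent_scaleA d e m :
  laurent_scale d (laurent_scale e m) = laurent_scale (d * e) m.
Proof.
move: m; apply: malg_additive_ext => [m n|m n|i c]; rewrite ?laurent_scaleB //.
by rewrite !laurent_scaleU mulrA.
Qed.

Lemma laurent_scale1 : left_id 1 laurent_scale.
Proof.
apply: malg_additive_ext => [m n|m n|i c]; rewrite ?laurent_scaleB //.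
by rewrite laurent_scaleU mul1r.
Qed.

Lemma laurent_scaleDr : right_distributive laurent_scale +%R.
Proof.
move=> d; pose f : {additive laurent -> laurent} := HB.pack (laurent_scale d)
  (GRing.isZmodMorphism.Build _ _ (laurent_scale d) (@laurent_scaleB d)).
exact: (raddfD f).
Qed.

Lemma laurent_scaleDl m : {morph laurent_scale^~ m : d e / d + e}.
Proof.
move=> d e; move: m; apply: malg_additive_ext => [m n|m n|i c].
- exact: laurent_scaleB.
- by rewrite !laurent_scaleB opprD addrACA.
- by rewrite !laurent_scaleU mulrDl monalgUD.
Qed.

HB.instance Definition _ := GRing.Zmodule_isLmodule.Build D laurent
  laurent_scaleA laurent_scale1 laurent_scaleDr laurent_scaleDl.

Lemma laurentZU d e i :
  d *: (<< e *g i >> : laurent) = << d * e *g i >> :> laurent.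
Proof. exact: laurent_scaleU. Qed.

Lemma laurentZB d : zmod_morphism (fun m : laurent => d *: m).
Proof. by move=> m n; rewrite scalerBr. Qed.

Definition shiftX : laurent -> laurent :=
  malg_lift (fun i d => << sigma d * xcoef i *g i + 1 >>).
Definition shiftY : laurent -> laurent :=
  malg_lift (fun i d => << tau d * ycoef i *g i - 1 >>).

Lemma shiftX_coefB i : zmod_morphism
  (fun d : D => << sigma d * xcoef i *g i + 1 >> : {malg D[int]}).
Proof. by move=> d e; rewrite rmorphB mulrBl monalgUB. Qed.

Lemma shiftY_coefB i : zmod_morphism
  (fun d : D => << tau d * ycoef i *g i - 1 >> : {malg D[int]}).
Proof. by move=> d e; rewrite rmorphB mulrBl monalgUB. Qed.

Lemma shiftXU d i :
  shiftX << d *g i >> = << sigma d * xcoef i *g i + 1 >>.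
Proof. exact: (malg_liftU shiftX_coefB). Qed.

Lemma shiftYU d i :
  shiftY << d *g i >> = << tau d * ycoef i *g i - 1 >>.
Proof. exact: (malg_liftU shiftY_coefB). Qed.

Lemma shiftXB : zmod_morphism shiftX.
Proof. exact: (malg_lift_additive shiftX_coefB). Qed.

Lemma shiftYB : zmod_morphism shiftY.
Proof. exact: (malg_lift_additive shiftY_coefB). Qed.

(** v_i applied to e_0 is e_i: this is why the v_i are independent over D. *)
Lemma gwa_op_shift1 i : gwa_op shiftX shiftY i << 1 *g 0 >> = << 1 *g i >>.
Proof.
case: i => i /=.
  elim: i => //= i ->.
  by rewrite shiftXU rmorph1 mulr1 -PoszD addn1.
elim: i => [|i IHi] /=.
  by rewrite shiftYU rmorph1 mulr1.
by move: IHi => /= ->; rewrite shiftYU rmorph1 mulr1 Negz_pred.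
Qed.

Lemma gwa_act1r (m : laurent) : gwa_act shiftX shiftY m << 1 *g 0 >> = m.
Proof.
move: m; apply: malg_additive_ext => [m n|m n|i d]; rewrite ?gwa_actBl //.
by rewrite gwa_actU gwa_op_shift1 laurentZU mulr1.
Qed.

Section Compose.
Variables (N : lmodType D) (X Y : N -> N).
Hypothesis XY_action : gwa_action X Y.

Lemma gwa_act1l n : gwa_act X Y << 1 *g 0 >> n = n.
Proof. by rewrite gwa_actU scale1r. Qed.

Lemma gwa_actZ d (m : laurent) n :
  gwa_act X Y (d *: m) n = d *: gwa_act X Y m n.
Proof.
move: m; apply: malg_additive_ext => [m1 m2|m1 m2|i c].
- by rewrite scalerBr gwa_actBl.
- by rewrite gwa_actBl scalerBr.
- by rewrite laurentZU !gwa_actU scalerA.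
Qed.

(** The map m |-> m . n carries the operator X of the model to that of N: both
   sides follow the same rule for moving x across d v_i. *)
Lemma gwa_act_shiftX m n : gwa_act X Y (shiftX m) n = X (gwa_act X Y m n).
Proof.
move: m; apply: malg_additive_ext => [m1 m2|m1 m2|i c].
- by rewrite shiftXB gwa_actBl.
- by rewrite gwa_actBl (gwa_XB XY_action).
by rewrite shiftXU !gwa_actU (gwa_XZ XY_action) (X_gwa_op XY_action) scalerA.
Qed.

Lemma gwa_act_shiftY m n : gwa_act X Y (shiftY m) n = Y (gwa_act X Y m n).
Proof.
move: m; apply: malg_additive_ext => [m1 m2|m1 m2|i c].
- by rewrite shiftYB gwa_actBl.
- by rewrite gwa_actBl (gwa_YB XY_action).
by rewrite shiftYU !gwa_actU (gwa_YZ XY_action) (Y_gwa_op XY_action) scalerA.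
Qed.

Lemma gwa_act_op i m n :
  gwa_act X Y (gwa_op shiftX shiftY i m) n = gwa_op X Y i (gwa_act X Y m n).
Proof.
case: i => [i|i] /=; first by elim: i => //= i IHi; rewrite gwa_act_shiftX IHi.
by elim: i => [|i IHi] /=; rewrite gwa_act_shiftY // IHi.
Qed.

(** Associativity of the action, with the composite action computed in the
   model. Both the associativity of the product of the model and the universal
   property are instances. *)
Lemma gwa_act_comp l m n :
  gwa_act X Y (gwa_act shiftX shiftY l m) n = gwa_act X Y l (gwa_act X Y m n).
Proof.
move: l; apply: malg_additive_ext => [l1 l2|l1 l2|i c].
- by rewrite gwa_actBl gwa_actBl.
- by rewrite gwa_actBl.
by rewrite !gwa_actU gwa_actZ gwa_act_op.
Qed.

End Compose.

Hypothesis tau_sigma_a : tau (sigma a) = a.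
Hypothesis a_comm : forall d : D, a * d = tau (sigma d) * a.
Hypothesis sigma_a_comm : forall d : D, sigma a * d = sigma (tau d) * sigma a.

(** For the last two relations: on d e_i, of the two coefficients met on going
   one step away and back, one is 1, and the other is a or sigma a according
   to the sign of i. So Y X multiplies tau (sigma d) by a or tau (sigma a),
   which are equal, and X Y multiplies sigma (tau d) by sigma a; the
   commutation hypotheses bring this factor to the left of d. *)
Lemma shift_action : gwa_action shiftX shiftY.
Proof.
split.
- exact: shiftXB.
- exact: shiftYB.
- move=> d; apply: malg_additive_ext => [m n|m n|i c].
  + by rewrite laurentZB shiftXB.
  + by rewrite shiftXB laurentZB.
  by rewrite laurentZU !shiftXU laurentZU rmorphM mulrA.
- move=> d; apply: malg_additive_ext => [m n|m n|i c].
  + by rewrite laurentZB shiftYB.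
  + by rewrite shiftYB laurentZB.
  by rewrite laurentZU !shiftYU laurentZU rmorphM mulrA.
- apply: malg_additive_ext => [m n|m n|i c].
  + by rewrite shiftXB shiftYB.
  + exact: laurentZB.
  rewrite shiftXU shiftYU laurentZU addrK rmorphM -mulrA a_comm.
  congr << _ * _ *g _ >>; case: i => [i|[|i]].
  + by rewrite -PoszD addn1 rmorph1 mul1r.
  + by rewrite /= mulr1.
  + by rewrite Negz_succ /= mulr1.
- apply: malg_additive_ext => [m n|m n|i c].
  + by rewrite shiftYB shiftXB.
  + exact: laurentZB.
  rewrite shiftYU shiftXU laurentZU subrK rmorphM -mulrA sigma_a_comm.
  congr << _ * _ *g _ >>; case: i => [[|i]|i].
  + by rewrite rmorph1 mul1r.
  + by rewrite Posz_pred mulr1.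
  + by rewrite Negz_pred rmorph1 mul1r.
Qed.

Definition gwa_mul (m n : laurent) : laurent := gwa_act shiftX shiftY m n.

Lemma gwa_mulA : associative gwa_mul.
Proof. by move=> l m n; rewrite /gwa_mul (gwa_act_comp shift_action). Qed.

Lemma gwa_mulDl : left_distributive gwa_mul +%R.
Proof.
move=> m n l; pose f : {additive laurent -> laurent} := HB.pack (gwa_mul^~ l)
  (GRing.isZmodMorphism.Build _ _ (gwa_mul^~ l) (gwa_actBl _ _ _)).
exact: (raddfD f).
Qed.

Lemma gwa_mulDr : right_distributive gwa_mul +%R.
Proof.
move=> m; pose f : {additive laurent -> laurent} := HB.pack (gwa_mul m)
  (GRing.isZmodMorphism.Build _ _ (gwa_mul m) (gwa_actBr shift_action _)).
exact: (raddfD f).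
Qed.

Definition gwa_model : pzRingType := HB.pack laurent
  (GRing.Zmodule_isPzRing.Build laurent gwa_mulA
    (gwa_act1l shiftX shiftY) gwa_act1r gwa_mulDl gwa_mulDr).

(** * The model satisfies the universal property *)

Definition model_iota (d : D) : gwa_model := << d *g 0 >>.

Lemma model_mulE (m n : gwa_model) : m * n = gwa_act shiftX shiftY m n.
Proof. by []. Qed.

Lemma model_iotaB : zmod_morphism model_iota.
Proof. by move=> d e; rewrite /model_iota monalgUB. Qed.

Lemma model_iota_mul d (m : gwa_model) :
  model_iota d * m = d *: (m : laurent).
Proof. by rewrite model_mulE gwa_actU. Qed.

Lemma model_iotaM : monoid_morphism model_iota.
Proof.
split=> // d e.
by rewrite model_iota_mul [RHS]laurentZU.
Qed.

HB.instance Definition _ :=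
  GRing.isZmodMorphism.Build D gwa_model model_iota model_iotaB.
HB.instance Definition _ :=
  GRing.isMonoidMorphism.Build D gwa_model model_iota model_iotaM.

Definition model_x : gwa_model := << 1 *g 1 >>.
Definition model_y : gwa_model := << 1 *g -1 >>.

Lemma model_x_mul (m : gwa_model) : model_x * m = shiftX m.
Proof. by rewrite model_mulE gwa_actU scale1r. Qed.

Lemma model_y_mul (m : gwa_model) : model_y * m = shiftY m.
Proof. by rewrite model_mulE gwa_actU scale1r. Qed.

Lemma model_relations : gwa_relations sigma tau a model_iota model_x model_y.
Proof.
split=> [d|d||].
- by rewrite model_x_mul model_iota_mul shiftXU laurentZU.
- by rewrite model_y_mul model_iota_mul shiftYU laurentZU.
- by rewrite model_y_mul shiftYU rmorph1 mul1r.
- by rewrite model_x_mul shiftXU rmorph1 mul1r.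
Qed.

Lemma model_monomial d i :
  model_iota d * gwa_v model_x model_y i = << d *g i >>.
Proof.
suff ->: gwa_v model_x model_y i = << 1 *g i >>.
  by rewrite model_iota_mul laurentZU mulr1.
rewrite -gwa_op_shift1; case: i => i /=.
  by elim: i => //= i IHi; rewrite exprS IHi model_x_mul.
elim: i => [|i IHi]; first by rewrite expr1 -[LHS]mulr1 model_y_mul.
by rewrite exprS IHi model_y_mul.
Qed.

Lemma model_generated : generated_by model_iota model_x model_y.
Proof.
move=> S [S1 SB SM] Siota Sx Sy u.
have S0 : 0 \in S by rewrite -(subrr 1) SB.
have SD : {in S &, forall v w, v + w \in S}.
  by move=> v w Sv Sw; rewrite -[w]opprK SB // -sub0r SB.
have SX w k : w \in S -> w ^+ k \in S.
  by move=> Sw; elim: k => [|k IHk]; rewrite ?expr0 ?exprS ?SM.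
rewrite [u](monalgE (u : {malg D[int]})); elim/big_ind: _ => // i _.
by rewrite -model_monomial SM //; case: i => i; apply: SX.
Qed.

(** A ring B satisfying the relations, seen as a left D-module, with x and y
   acting by left multiplication. *)
Section Universal.
Variables (B : pzRingType) (f : {rmorphism D -> B}) (x y : B).
Hypothesis fxy : gwa_relations sigma tau a f x y.

Let mulx (u : left_mod f) : left_mod f := x * (u : B).
Let muly (u : left_mod f) : left_mod f := y * (u : B).

Lemma left_modZ d (u : left_mod f) : d *: u = f d * (u : B).
Proof. by []. Qed.

Lemma left_mul_action : gwa_action mulx muly.
Proof.
case: fxy => xf yf yx xy; split=> [u v|u v|d u|d u|u|u].
- exact: mulrBr.
- exact: mulrBr.
- by rewrite !left_modZ /mulx mulrA xf mulrA.
- by rewrite !left_modZ /muly mulrA yf mulrA.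
- by rewrite left_modZ /muly /mulx mulrA yx.
- by rewrite left_modZ /muly /mulx mulrA xy.
Qed.

Lemma gwa_op_left_mul i (u : left_mod f) :
  gwa_op mulx muly i u = gwa_v x y i * (u : B).
Proof.
case: i => i.
  by elim: i => /= [|i ->]; rewrite ?mul1r // exprS -mulrA.
elim: i => // i IHi; rewrite -[LHS]/(muly (gwa_op mulx muly (Negz i) u)).
by rewrite IHi /= (exprS y i.+1) -mulrA.
Qed.

(** The morphism induced by (f, x, y): the element m of the model acts on B,
   and its image is its value at 1. *)
Definition model_eval (m : gwa_model) : B := gwa_act mulx muly m 1.

Lemma gwa_act_left_mul m (u : left_mod f) :
  gwa_act mulx muly m u = model_eval m * (u : B).
Proof.
rewrite /model_eval /gwa_act /malg_lift mulr_suml; apply: eq_bigr => i _.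
by rewrite !left_modZ !gwa_op_left_mul mulr1 mulrA.
Qed.

Lemma model_evalU d i : model_eval << d *g i >> = f d * gwa_v x y i.
Proof. by rewrite /model_eval gwa_actU gwa_op_left_mul mulr1. Qed.

Lemma model_evalB : zmod_morphism model_eval.
Proof.
by move=> m n; exact: (gwa_actBl mulx muly (1 : left_mod f) m n).
Qed.

Lemma model_evalM : monoid_morphism model_eval.
Proof.
split=> [|m n]; first by rewrite model_evalU rmorph1 mul1r.
by rewrite -gwa_act_left_mul /model_eval (gwa_act_comp left_mul_action).
Qed.

HB.instance Definition _ :=
  GRing.isZmodMorphism.Build gwa_model B model_eval model_evalB.
HB.instance Definition _ :=
  GRing.isMonoidMorphism.Build gwa_model B model_eval model_evalM.

Definition model_eval_rmorphism : {rmorphism gwa_model -> B} := model_eval.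

End Universal.

Lemma model_is_gwa : is_gwa sigma tau a model_iota model_x model_y.
Proof.
split=> [||B f x y fxy]; [exact: model_relations | exact: model_generated |].
exists (model_eval_rmorphism fxy); split=> [d||] /=; rewrite model_evalU.
- by rewrite mulr1.
- by rewrite rmorph1 mul1r.
- by rewrite rmorph1 mul1r.
Qed.

(** * Grading and freeness of any generalized Weyl algebra *)

Section Gwa.
Variables (A : pzRingType) (iota : {rmorphism D -> A}) (x y : A).
Hypothesis A_gwa : is_gwa sigma tau a iota x y.

Local Notation v := (gwa_v x y).

(** The universal property gives g : A -> model and the model gives h back to
   A. As h (g u) = u on the generators, it holds everywhere, so u is determined
   by the coordinates of g u; and g maps d v_i to d e_i. *)
Lemma gwa_coordinates : exists g : {additive A -> {malg D[int]}},
  (forall d i, g (iota d * v i) = << d *g i >>) /\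
  (forall u, u = \sum_(i <- msupp (g u)) iota (g u)@_i * v i).
Proof.
have [Arel Agen Auniv] := A_gwa.
have [g [g_iota gx gy]] := Auniv _ _ _ _ model_relations.
have gU d i : g (iota d * v i) = << d *g i >>.
  rewrite -model_monomial -g_iota rmorphM; congr (_ * _).
  by case: i => i /=; rewrite rmorphXn ?gx ?gy.
pose h := model_eval_rmorphism Arel.
have hg u : h (g u) = u.
  (* The fixed points of h \o g form a subring containing the generators. *)
  pose S := [pred u | h (g u) == u]; apply/eqP; rewrite -[_ == _]/(u \in S).
  apply: Agen; rewrite ?inE.
  - split=> [|s t|s t]; rewrite !inE ?rmorph1 // => /eqP hs /eqP ht.
      by rewrite !rmorphB hs ht.
    by rewrite !rmorphM hs ht.
  - by move=> d; rewrite inE g_iota /= model_evalU mulr1.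
  - by rewrite gx /= model_evalU rmorph1 mul1r.
  - by rewrite gy /= model_evalU rmorph1 mul1r.
exists g; split=> [|u]; first exact: gU.
rewrite -[LHS]hg /= /model_eval /gwa_act /malg_lift.
by apply: eq_bigr => i _; rewrite left_modZ gwa_op_left_mul mulr1.
Qed.

Lemma gwa_comp_subgroup i : is_additive_subgroup (gwa_comp iota x y i).
Proof.
split=> [|_ _ [d ->] [e ->]]; first by exists 0; rewrite rmorph0 mul0r.
by exists (d - e); rewrite rmorphB mulrBl.
Qed.

Lemma x_gwa_v i : x * v i = iota (xcoef i) * v (i + 1).
Proof.
have [Arel _ _] := A_gwa.
have := X_gwa_op (left_mul_action Arel) i (1 : A).
by rewrite left_modZ !gwa_op_left_mul !mulr1.
Qed.

Lemma y_gwa_v i : y * v i = iota (ycoef i) * v (i - 1).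
Proof.
have [Arel _ _] := A_gwa.
have := Y_gwa_op (left_mul_action Arel) i (1 : A).
by rewrite left_modZ !gwa_op_left_mul !mulr1.
Qed.

(** Since v_i is a power of x or of y, it suffices that left multiplication by
   x and by y shifts the degree by one. *)
Lemma gwa_comp_mul i j u w :
  gwa_comp iota x y i u -> gwa_comp iota x y j w ->
  gwa_comp iota x y (i + j) (u * w).
Proof.
have [[xd yd _ _] _ _] := A_gwa.
move=> [d ->] Aw.
suff [e ve] : gwa_comp iota x y (i + j) (v i * w).
  by exists (d * e); rewrite rmorphM -!mulrA ve.
have Ax k t : gwa_comp iota x y k t -> gwa_comp iota x y (k + 1) (x * t).
  move=> [e ->]; exists (sigma e * xcoef k).
  by rewrite mulrA xd -mulrA x_gwa_v mulrA -rmorphM.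
have Ay k t : gwa_comp iota x y k t -> gwa_comp iota x y (k - 1) (y * t).
  move=> [e ->]; exists (tau e * ycoef k).
  by rewrite mulrA yd -mulrA y_gwa_v mulrA -rmorphM.
case: i => i /=.
  elim: i => [|i IHi]; first by rewrite add0r mul1r.
  by rewrite exprS -mulrA -addn1 PoszD addrAC; apply: Ax.
elim: i => [|i IHi]; first by rewrite expr1 addrC; apply: Ay.
by rewrite exprS -mulrA -Negz_pred addrAC; apply: Ay.
Qed.

(** The component of u in A_i is its i-th coordinate times v_i; conversely,
   in any decomposition, only the component in A_i contributes to the i-th
   coordinate. *)
Lemma gwa_direct_sum : is_direct_sum (gwa_comp iota x y).
Proof.
have [g [gU gE]] := gwa_coordinates.
move=> u.
pose c0 : {fsfun int -> A with 0} :=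
  [fsfun i in msupp (g u) => iota (g u)@_i * v i].
have c0E i : c0 i = iota (g u)@_i * v i.
  by rewrite fsfunE; case: msuppP; rewrite // rmorph0 mul0r.
exists c0; split=> [|c [Ac uE]].
  split=> [i|]; first by rewrite c0E; exists (g u)@_i.
  rewrite {1}[u]gE.
  rewrite [RHS](big_fset_incl _ (finsupp_sub _ _ _)) => [|i _]; last first.
    by apply: contraNeq; rewrite mem_finsupp.
  by apply: eq_bigr => i _; rewrite c0E.
(* An element of A_j has no coordinate other than the j-th one. *)
have gc i j : (g (c j))@_i = (g (c j))@_j *+ (i == j).
  by have [d ->] := Ac j; rewrite gU mcoeffUU mcoeffU eq_sym.
have guE i : (g u)@_i = (g (c i))@_i.
  rewrite uE raddf_sum (raddf_sum (mcoeff i)) /=.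
  under eq_bigr do rewrite gc mulrb.
  rewrite -big_mkcond; case: (boolP (i \in finsupp c)) => ci.
    rewrite -big_filter (@eq_filter _ _ (pred1 i)) => [|j]; last exact: eq_sym.
    by rewrite filter_pred1_uniq ?big_seq1 ?fset_uniq.
  rewrite (fsfun_dflt ci) raddf0 mcoeff0 big_seq_cond big1 // => j.
  by case/andP=> cj /eqP ij; rewrite ij cj in ci.
apply/fsfunP => i; rewrite c0E guE.
by have [d cd] := Ac i; rewrite cd gU mcoeffUU.
Qed.

Lemma gwa_comp_regular i : exists phi : {linear D^o -> left_mod iota},
  [/\ phi 1 = v i, injective phi & range phi = gwa_comp iota x y i].
Proof.
have [g [gU _]] := gwa_coordinates.
pose f (d : D^o) : left_mod iota := iota d * v i.
have fB : zmod_morphism f by move=> d e; rewrite /f rmorphB mulrBl.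
have fZ : scalable f.
  by move=> d e; rewrite left_modZ /f rmorphM mulrA.
pose phi : {linear D^o -> left_mod iota} := HB.pack f
  (GRing.isZmodMorphism.Build _ _ f fB) (GRing.isScalable.Build D _ _ _ f fZ).
exists phi; split.
- by rewrite /= /f rmorph1 mul1r.
- by move=> d e /(congr1 (fun u => (g u)@_i)); rewrite /= /f !gU !mcoeffUU.
- by apply/seteqP; split=> [_ [d _ <-]|_ [d ->]]; exists d.
Qed.

Lemma gwa_free : is_free_module (left_mod iota).
Proof.
have [g [gU gE]] := gwa_coordinates.
exists int, v => u; exists (malg_val (g u)); split; first exact: gE.
move=> c uE; rewrite -[RHS]mkmalgK; congr malg_val.
rewrite [RHS]monalgE uE raddf_sum; apply: eq_bigr => i _.
by rewrite left_modZ gU.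
Qed.

End Gwa.

End Action.

Theorem theorem2p2 (D : pzRingType) (sigma tau : {rmorphism D -> D}) (a : D)
  (tau_sigma_a : tau (sigma a) = a)
  (a_comm : forall d : D, a * d = tau (sigma d) * a)
  (sigma_a_comm : forall d : D, sigma a * d = sigma (tau d) * sigma a) :
  (exists (A : pzRingType) (iota : {rmorphism D -> A}) (x y : A),
     is_gwa sigma tau a iota x y)
  /\
  (forall (A : pzRingType) (iota : {rmorphism D -> A}) (x y : A),
     is_gwa sigma tau a iota x y ->
     [/\ is_Zgrading (gwa_comp iota x y),
         forall i : int, exists phi : {linear D^o -> left_mod iota},
           [/\ phi 1 = gwa_v x y i,
               injective phi
             & range phi = gwa_comp iota x y i]
       & is_free_module (left_mod iota)]).
Proof.
split; first exact: (ex_intro _ _ (ex_intro _ _ (ex_intro _ _ (ex_intro _ _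
  (model_is_gwa tau_sigma_a a_comm sigma_a_comm))))).
move=> A iota x y A_gwa; split.
- split=> [i||]; [exact: gwa_comp_subgroup | exact: gwa_direct_sum A_gwa |].
  by move=> i j u w; apply: gwa_comp_mul A_gwa _ _ _ _.
- exact: gwa_comp_regular A_gwa.
- exact: gwa_free A_gwa.
Qed.
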